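(* Let $r\geq 3$ be an integer, let $\mathbb{K}$ be a field, and let $G$ be the complement of the $r$-barbell graph, with vertex set $V(G)=\{x_1,\dots,x_{2r}\}$. Then $\operatorname{pdim}\mathbb{K}[\Delta_G]=2r-2$ and $\max_{1\leq i\leq 2r}\{\deg_G(x_i)\}=r$; therefore $$\operatorname{pdim}\mathbb{K}[\Delta_G]-\max_{1\leq i\leq 2r}\{\deg_G(x_i)\}=r-2.$$
   Context: The $r$-barbell graph is the (chordal) graph on $2r$ vertices obtained by taking two disjoint copies of the complete graph $\mathcal{K}_r$ on $r$ vertices and connecting them by a bridge, i.e. adding exactly one edge joining a vertex of the first copy to a vertex of the second copy. The complement of a graph has the same vertex set, and two distinct vertices are adjacent in the complement iff they are not adjacent in the original graph. $R=\mathbb{K}[x_1,\dots,x_{2r}]$ is the polynomial ring over $\mathbb{K}$ with variables the vertices of $G$; $I(G)=(x_ix_j\mid \{x_i,x_j\}\in E(G))\subseteq R$ is the edge ideal; $\Delta_G$ is the independence complex of $G$ (the simplicial complex of all independent sets), whose Stanley--Reisner ring is $\mathbb{K}[\Delta_G]=R/I(G)$. $\operatorname{pdim}\mathbb{K}[\Delta_G]$ is the projective dimension of $R/I(G)$ as an $R$-module, i.e. the length of its minimal graded free resolution over $R$. $\deg_G(x)$ is the number of neighbours of $x$ in $G$. *)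

(* Defs.v *)
From mathcomp Require Import all_boot all_order all_algebra.
From mathcomp Require Import mpoly.
From Stdlib Require Import ClassicalEpsilon.

Set Implicit Arguments.
Unset Strict Implicit.
Unset Printing Implicit Defensive.

Import GRing.Theory.
Local Open Scope ring_scope.

(* A graph on the finite vertex type T is given by its adjacency relation. *)

Section Graphs.
Variable T : finType.

Definition graph_compl (e : rel T) : rel T :=
  fun x y => (x != y) && ~~ e x y.

Definition graph_deg (e : rel T) (x : T) : nat := #|[set y | e x y]|.

(* A and ~: A are the vertex sets of the two copies of K_r, and {a, b} is the
   bridge; the labelling of the vertices is arbitrary. *)
Definition is_barbell (r : nat) (e : rel T) : Prop :=
  exists (A : {set T}) (a b : T),
    [/\ #|A| = r, #|~: A| = r, a \in A, b \notin A
      & forall x y : T,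
          e x y = (x != y) &&
                  [|| (x \in A) == (y \in A),
                      (x == a) && (y == b) | (x == b) && (y == a)]].

Definition independence_complex (e : rel T) : {set {set T}} :=
  [set S : {set T} | [forall x in S, forall y in S, ~~ e x y]].

End Graphs.

Section Ideals.
Variables (K : fieldType) (n : nat).
Local Notation R := {mpoly K[n]}.

(* The ideal of R generated by the g t with P t, as a subset of R. *)
Definition ideal_gen (T : finType) (P : pred T) (g : T -> R) (f : R) : Prop :=
  exists c : T -> R, f = \sum_(t | P t) c t * g t.

Definition edge_ideal (e : rel 'I_n) : R -> Prop :=
  ideal_gen (fun ij : 'I_n * 'I_n => e ij.1 ij.2)
            (fun ij => 'X_(ij.1) * 'X_(ij.2)).

Definition stanley_reisner_ideal (D : {set {set 'I_n}}) : R -> Prop :=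
  ideal_gen (fun S : {set 'I_n} => S \notin D) (fun S => \prod_(i in S) 'X_i).

(* Hence K[Delta_G] = R / I(G). *)
Lemma stanley_reisner_independence (e : rel 'I_n) : irreflexive e ->
  forall f : R,
    stanley_reisner_ideal (independence_complex e) f <-> edge_ideal e f.
Proof.
have gen_sub (T U : finType) (P : pred T) (g : T -> R) (Q : pred U)
    (h : U -> R) : (forall t, P t -> ideal_gen Q h (g t)) ->
    forall f, ideal_gen P g f -> ideal_gen Q h f.
  move=> PQ _ [c ->].
  have aux t : exists b : U -> R, P t -> g t = \sum_(u | Q u) b u * h u.
    case: (boolP (P t)) => [/PQ [b Hb]|_]; last by exists (fun=> 0).
    by exists b.
  pose b t := proj1_sig (constructive_indefinite_description _ (aux t)).
  have Hb t : P t -> g t = \sum_(u | Q u) b t u * h u.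
    exact: (proj2_sig (constructive_indefinite_description _ (aux t))).
  exists (fun u => \sum_(t | P t) c t * b t u).
  under [RHS]eq_bigr => u _ do rewrite mulr_suml.
  rewrite exchange_big /=; apply: eq_bigr => t /Hb ->.
  by rewrite mulr_sumr; apply: eq_bigr => u _; rewrite mulrA.
have gen_mem (T : finType) (P : pred T) (g : T -> R) t (a : R) :
    P t -> ideal_gen P g (a * g t).
  move=> Pt; exists (fun u => if u == t then a else 0).
  rewrite (bigD1 t) //= eqxx big1 ?addr0 // => u /andP[_ /negPf ->].
  by rewrite mul0r.
move=> irr f; split; last first.
  apply: gen_sub => -[i j] /= eij.
  have neq : j != i by apply: contraTneq eij => ->; rewrite irr.
  have -> : 'X_i * 'X_j = 1 * \prod_(k in [set i; j]) 'X_k :> R.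
    by rewrite mul1r big_setU1 ?big_set1 // inE eq_sym.
  apply: (@gen_mem _ _ (fun S : {set 'I_n} => \prod_(k in S) 'X_k)).
  rewrite inE negb_forall; apply/existsP; exists i.
  rewrite negb_imply !inE eqxx /= negb_forall; apply/existsP; exists j.
  by rewrite negb_imply !inE eqxx orbT negbK.
apply: gen_sub => S.
rewrite inE negb_forall => /existsP[i]; rewrite negb_imply => /andP[iS].
rewrite negb_forall => /existsP[j]; rewrite negb_imply negbK => /andP[jS eij].
have neq : j != i by apply: contraTneq eij => ->; rewrite irr.
rewrite (bigD1 i) //= (bigD1 j) ?jS //= mulrA mulrC.
exact: (@gen_mem _ _ (fun ij : 'I_n * 'I_n => 'X_(ij.1) * 'X_(ij.2)) (i, j)).
Qed.

End Ideals.

Section ProjectiveDimension.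
Variables (K : fieldType) (n : nat).
Local Notation R := {mpoly K[n]}.

(* f is homogeneous of the possibly negative degree a. *)
Definition homog_deg (a : int) (f : R) : Prop :=
  match a with Posz m => f \is m.-homog | Negz _ => f = 0 end.

(* A minimal graded free resolution
     ... -> F_2 -> F_1 -> F_0 -> R / I -> 0,   F_i = \bigoplus_j R(- shift i j),
   of the R-module R / I.  Elements of F_i are row vectors, on which
   matrices act from the right; the map F_0 -> R / I sends u to the class of
   u *m aug.  Minimality: the entries of the differentials lie in the
   homogeneous maximal ideal (x_1, ..., x_n). *)
Record min_graded_free_resolution (I : R -> Prop) := MinGradedFreeResolution {
  rk : nat -> nat;
  shift : forall i, 'I_(rk i) -> int;
  aug : 'cV[R]_(rk 0%N);
  diff : forall i, 'M[R]_(rk i.+1, rk i);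
  aug_graded : forall k, homog_deg (shift k) (aug k 0);
  diff_graded : forall i j k, homog_deg (shift j - shift k) (diff i j k);
  aug_surjective : forall f : R, exists u : 'rV_(rk 0%N),
    I (f - (u *m aug) 0 0);
  exact_aug : forall u : 'rV_(rk 0%N),
    I ((u *m aug) 0 0) <-> exists v : 'rV_(rk 1%N), u = v *m diff 0%N;
  exact_diff : forall i (u : 'rV_(rk i.+1)),
    u *m diff i = 0 <-> exists v : 'rV_(rk i.+2), u = v *m diff i.+1;
  diff_minimal : forall i j k, (diff i j k)@_0%MM = 0
}.

Definition resolution_length (I : R -> Prop)
    (F : min_graded_free_resolution I) (p : nat) : Prop :=
  rk F p <> 0%N /\ forall i, (p < i)%N -> rk F i = 0%N.

Definition is_pdim (I : R -> Prop) (p : nat) : Prop :=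
  exists F : min_graded_free_resolution I, resolution_length F p.

(* The projective dimension of R / I, for a proper homogeneous ideal I:
   the p such that is_pdim I p. *)
Definition pdim_quotient (I : R -> Prop) : nat :=
  epsilon (inhabits 0%N) (is_pdim I).

End ProjectiveDimension.

(* The projective dimension of the Stanley-Reisner ring K[D] = R / I_D. *)
Definition pdim_stanley_reisner (K : fieldType) (n : nat)
    (D : {set {set 'I_n}}) : nat :=
  pdim_quotient (@stanley_reisner_ideal K n D).

(* Main.v *)
From HB Require Import structures.
Require Import Defs.
From mathcomp Require Import all_boot all_order all_algebra.
From mathcomp Require Import mpoly.
From mathcomp Require Import zify.
From Stdlib Require Import ClassicalEpsilon.

(** The complement of the barbell is the complete bipartite graph between the
    two cliques A and ~: A with the edge joining the ends a, b of the bridge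
    removed.  A vertex other than a and b is therefore joined to all r vertices
    of the other side, and no vertex has more neighbours; this is the statement
    on degrees.

    For the projective dimension, the edge ideal has linear quotients.
    Enumerate the two sides so that a and b come last, and adjoin the generators
    x_i y_j in lexicographic order.  The ideal of the generators that precede
    x_i y_j, colon x_i y_j, is generated by the variables x_k with k < i and
    y_l with l < j (bipartite_colon), and its quotient is resolved by a Koszul
    complex, of length (i - 1) + (j - 1).  The mapping cone of a lift of the
    multiplication by x_i y_j is a resolution of the quotient by the larger
    ideal (mapping_cone).  As every ideal in sight has a linear resolution, so
    does the cone, and a linear resolution is minimal.  Each step raises the
    projective dimension to at least (i - 1) + (j - 1) + 1; since x_r y_r is the
    missing edge, the largest value comes from x_r y_(r-1) and is 2r - 2.

    The Koszul complexes come from the same mapping cone, since a variable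
    outside a set of variables is a nonzerodivisor modulo the ideal generated by
    that set.

    Finally, the length of a minimal resolution depends on the ideal only.  Two
    resolutions are linked by comparison maps whose composite is homotopic to
    the identity; where one resolution vanishes, the homotopy writes the
    identity matrix of the other as a combination of its differentials, whose
    entries have no constant term, so the other vanishes too (rk_eq0). *)

Set Implicit Arguments.
Unset Strict Implicit.
Unset Printing Implicit Defensive.

Import GRing.Theory.

(** * Uniqueness of the length of a minimal resolution *)

(** Comparison maps and homotopies are built degree by degree, the matrix in
    degree i + 1 depending on the one in degree i; P is the solvability
    condition that keeps the recursion going. *)
Lemma dependent_choice (T : nat -> Type) (P : forall i, T i -> Prop)
    (Q : forall i, T i -> T i.+1 -> Prop) (x0 : T 0) :
  P 0 x0 ->
  (forall i x, P i x -> exists y, P i.+1 y /\ Q i x y) ->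
  exists2 s : forall i, T i, s 0 = x0 & forall i, Q i (s i) (s i.+1).
Proof.
move=> P0 step.
pose next i (x : {x | P i x}) :=
  constructive_indefinite_description _ (step i (sval x) (svalP x)).
pose s := fix s i : {x | P i x} :=
  if i is j.+1 then exist _ _ (proj1 (svalP (next j (s j)))) else exist _ x0 P0.
by exists (fun i => sval (s i)) => // i; case: (svalP (next i (s i))).
Qed.

Section Rows.
Local Open Scope ring_scope.

Lemma lift_rows (R : pzSemiRingType) m p q (A : 'M[R]_(m, p)) (B : 'M_(q, p)) :
  (forall k, exists v : 'rV_q, row k A = v *m B) -> exists X, A = X *m B.
Proof.
move=> /fin_all_exists [v Hv]; exists (\matrix_k v k).
by apply/row_matrixP => k; rewrite row_mul rowK.
Qed.

End Rows.

Section Comparison.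
Local Open Scope ring_scope.
Variables (K : fieldType) (n : nat).
Local Notation R := {mpoly K[n]}.

Definition is_ideal (I : R -> Prop) :=
  [/\ I 0, forall f g, I f -> I g -> I (f + g) & forall a f, I f -> I (a * f)].

Variable I : R -> Prop.
Hypothesis idealI : is_ideal I.

Lemma ideal_mulmx m q (A : 'M[R]_(m, q)) (c : 'cV_q) :
  (forall k, I (c k 0)) -> forall k, I ((A *m c) k 0).
Proof.
case: idealI => I0 ID IM cI k; rewrite mxE.
by elim/big_ind: _ => // j _; apply: IM.
Qed.

Implicit Types F G : min_graded_free_resolution I.

Lemma exact_aug_mx F m (A : 'M_(m, rk F 0)) :
  (forall k, I ((A *m aug F) k 0)) <-> exists X, A = X *m diff F 0.
Proof.
have rowE k : (A *m aug F) k 0 = (row k A *m aug F) 0 0.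
  by rewrite -row_mul [RHS]mxE.
split=> [AI | [X eA] k].
  by apply: lift_rows => k; apply/exact_aug; rewrite -rowE.
by rewrite rowE; apply/exact_aug; exists (row k X); rewrite eA row_mul.
Qed.

Lemma diff_diff F i : diff F i.+1 *m diff F i = 0.
Proof.
apply/row_matrixP => k; rewrite row0 row_mul; apply/exact_diff.
by exists (delta_mx 0 k); rewrite rowE.
Qed.

Lemma exact_diff_mx F i m (A : 'M_(m, rk F i.+1)) :
  A *m diff F i = 0 -> exists X, A = X *m diff F i.+1.
Proof.
move=> A0; apply: lift_rows => k; apply/exact_diff.
by rewrite -row_mul A0 row0.
Qed.

Lemma diff_aug F k : I ((diff F 0 *m aug F) k 0).
Proof. by move: k; apply/exact_aug_mx; exists 1%:M; rewrite mul1mx. Qed.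

(** The identity of R / I lifts to a chain map between two resolutions. *)
Lemma comparison F G : exists2 al : forall i, 'M[R]_(rk F i, rk G i),
    forall k, I ((aug F - al 0%N *m aug G) k 0)
  & forall i, diff F i *m al i = al i.+1 *m diff G i.
Proof.
case: (idealI) => I0 ID IM.
have [al0 Hal0] : exists al0 : 'M[R]_(rk F 0, rk G 0),
    forall k, I ((aug F - al0 *m aug G) k 0).
  have /fin_all_exists [u Hu] k := aug_surjective G (aug F k 0).
  exists (\matrix_k u k) => k.
  by have := Hu k; rewrite !mxE; under [in X in _ -> X]eq_bigr do rewrite mxE.
have [] := @dependent_choice (fun i => 'M[R]_(rk F i, rk G i))
  (fun i al => exists X, diff F i *m al = X *m diff G i)
  (fun i al al' => diff F i *m al = al' *m diff G i) al0.
- apply/exact_aug_mx => k; rewrite -mulmxA.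
  have := ideal_mulmx (diff F 0) Hal0 k.
  rewrite mulmxBr; set x := _ *m aug F; set y := diff F 0 *m _ => xy.
  have -> : y k 0 = -1 * (x - y) k 0 + x k 0.
    by rewrite !mxE mulN1r opprB subrK.
  by apply: ID; [apply: IM | apply: diff_aug].
- move=> i al [X eX]; exists X; split=> //; apply: exact_diff_mx.
  by rewrite -mulmxA -eX mulmxA diff_diff mul0mx.
by move=> al e0 eal; exists al; rewrite ?e0.
Qed.

(** A chain map that induces 0 on R / I is null-homotopic. *)
Lemma null_homotopy F (de : forall i, 'M[R]_(rk F i)) :
  (forall k, I ((de 0%N *m aug F) k 0)) ->
  (forall i, diff F i *m de i = de i.+1 *m diff F i) ->
  exists2 h : forall i, 'M[R]_(rk F i, rk F i.+1),
    de 0%N = h 0%N *m diff F 0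
  & forall i, de i.+1 = diff F i *m h i + h i.+1 *m diff F i.+1.
Proof.
move=> /exact_aug_mx [h0 Hh0] de_chain.
have [] := @dependent_choice (fun i => 'M[R]_(rk F i, rk F i.+1))
  (fun i h => exists X, de i.+1 - diff F i *m h = X *m diff F i.+1)
  (fun i h h' => de i.+1 - diff F i *m h = h' *m diff F i.+1) h0.
- by apply: exact_diff_mx; rewrite mulmxBl -de_chain Hh0 mulmxA subrr.
- move=> i h [X eX]; exists X; split=> //; apply: exact_diff_mx.
  rewrite mulmxBl -de_chain -mulmxA -eX mulmxBr opprB addrCA subrr addr0.
  by rewrite mulmxA diff_diff mul0mx.
move=> h e0 eh; exists h; first by rewrite e0.
by move=> i; rewrite -eh addrC subrK.
Qed.

(** With al : F -> G and be : G -> F comparison maps, 1 - al be is homotopic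
    to 0.  In degree i it equals 1 because al be factors through G_i = 0, so 1
    is a sum of products with a differential of F; by minimality such a sum has
    no constant term. *)
Lemma rk_eq0 F G i : rk G i = 0%N -> rk F i = 0%N.
Proof.
move=> G0.
have [al al0 al_chain] := comparison F G.
have [be be0 be_chain] := comparison G F.
pose de i := 1%:M - al i *m be i.
have [||h h0 hS] := @null_homotopy F de.
- move=> k; case: (idealI) => I0 ID IM.
  have -> : de 0%N *m aug F =
      (aug F - al 0%N *m aug G) + al 0%N *m (aug G - be 0%N *m aug F).
    by rewrite mulmxBl mul1mx mulmxBr addrA subrK mulmxA.
  by rewrite mxE; apply: ID; [apply: al0 | apply: ideal_mulmx be0 k].
- move=> j; rewrite /de mulmxBr mulmxBl mulmx1 mul1mx.
  by rewrite [in LHS]mulmxA al_chain -!mulmxA be_chain.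
have de1 : de i = 1%:M.
  rewrite /de; apply/matrixP => j k; rewrite !mxE big1 ?subr0 // => l _.
  by have := ltn_ord l; rewrite {2}G0.
have ev0 (f : R) : mcoeff 0%MM f = 0 -> forall g, mcoeff 0%MM (f * g) = 0.
  by move=> f0 g; rewrite rmorphM /= f0 mul0r.
have [e|[k]] : rk F i = 0%N \/ inhabited 'I_(rk F i).
  by case: (rk F i) => [|m]; [left | right; exists; apply: ord0].
- exact: e.
have := congr1 (fun M : 'M[R]_(rk F i) => mcoeff 0%MM (M k k)) de1.
suff -> : mcoeff 0%MM (de i k k) = 0.
  by rewrite !mxE eqxx mcoeff1 eqxx => /eqP; rewrite eq_sym oner_eq0.
clear -h0 hS ev0; case: i k => [|i] k.
  rewrite h0 mxE raddf_sum big1 //= => l _.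
  by rewrite mulrC ev0 // diff_minimal.
rewrite hS 3!mxE raddfD /= !raddf_sum !big1 ?addr0 //= => l _.
  by rewrite mulrC ev0 // diff_minimal.
by rewrite ev0 // diff_minimal.
Qed.

Lemma resolution_length_unique p q : is_pdim I p -> is_pdim I q -> p = q.
Proof.
have le p' q' : is_pdim I p' -> is_pdim I q' -> (p' <= q')%N.
  move=> [F [Fp _]] [G [_ Gq]]; rewrite leqNgt; apply/negP => /Gq G0.
  exact: Fp (rk_eq0 _ G0).
by move=> Ip Iq; apply/eqP; rewrite eqn_leq !le.
Qed.

Lemma pdim_quotientE p : is_pdim I p -> pdim_quotient I = p.
Proof.
move=> Ip; have Iq : is_pdim I (pdim_quotient I).
  by apply: epsilon_spec; exists p.
exact: resolution_length_unique Iq Ip.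
Qed.

End Comparison.

(** * Graded lifting *)

Section Homogeneous.
Local Open Scope ring_scope.
Variables (K : fieldType) (n : nat).
Local Notation R := {mpoly K[n]}.

Definition homog_mx d p q (A : 'M[R]_(p, q)) :=
  forall i j, A i j \is d.-homog.

(** Taking a homogeneous component commutes with the multiplication by a
    homogeneous g, up to the shift by the degree of g. *)
Lemma pihomogM_homog t (g : R) s v : g \is t.-homog ->
  pihomog mdeg (s + t) (v * g) = pihomog mdeg s v * g.
Proof.
move=> hg; rewrite {1}[v](pihomog_partitionE (mf := mdeg) (leqnn _)).
set N := mmeasure _ _.
rewrite mulr_suml raddf_sum /=.
have hd d : pihomog mdeg (s + t) (pihomog mdeg d v * g) =
    if d == s then pihomog mdeg d v * g else 0.
  have hvg : pihomog mdeg d v * g \is (d + t).-homog.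
    by apply: dhomogM => //; apply: pihomogP.
  case: eqP => [<- | /eqP ne]; first exact: pihomog_dE.
  by rewrite (pihomog_ne0 (d := (d + t)%N)) // eqn_add2r.
under eq_bigr do rewrite hd.
rewrite -big_mkcond /=; have [sN | Ns] := ltnP s N.
  by rewrite (big_pred1 (Ordinal sN)).
rewrite big_pred0; last first.
  by move=> i; apply/negbTE; rewrite neq_ltn (leq_trans (ltn_ord i)).
rewrite pihomogE big_seq_cond big_pred0 ?mul0r // => m.
apply/negbTE; rewrite negb_and -implybE; apply/implyP => mv.
by rewrite neq_ltn (leq_trans _ Ns) // mmeasure_mnm_lt.
Qed.

Lemma homog_mulmx s t p q l (A : 'M[R]_(p, q)) (B : 'M_(q, l)) :
  homog_mx s A -> homog_mx t B -> homog_mx (s + t) (A *m B).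
Proof.
move=> hA hB i j; rewrite mxE; apply: rpred_sum => k _.
by apply: dhomogM; [apply: hA | apply: hB].
Qed.

(** Homogeneous data have homogeneous lifts: keep the component of degree s of
    an arbitrary lift. *)
Lemma homog_lift s t p q l (A : 'M[R]_(p, l)) (B : 'M_(q, l)) :
  homog_mx (s + t) A -> homog_mx t B -> (exists X, A = X *m B) ->
  exists2 X, homog_mx s X & A = X *m B.
Proof.
move=> hA hB [X eA]; exists (map_mx (pihomog mdeg s) X).
  by move=> i j; rewrite mxE; apply: pihomogP.
apply/matrixP => i j; rewrite -(pihomog_dE (hA i j)) eA !mxE raddf_sum /=.
by apply: eq_bigr => k _; rewrite mxE pihomogM_homog.
Qed.

End Homogeneous.

(** * Linear resolutions and mapping cones *)

Section LinearResolutions.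
Local Open Scope ring_scope.
Variables (K : fieldType) (n : nat).
Local Notation R := {mpoly K[n]}.

(** The ranks of a resolution of a cyclic module: b lists those of degree at
    least 1, and degree 0 has rank 1 by computation, so that the augmentation
    is the quotient map itself. *)
Definition ranks (b : nat -> nat) i := if i is j.+1 then b j else 1%N.

Definition lin_deg (d i : nat) := if i is _.+1 then 1%N else d.

(** Degree i >= 1 is generated by elements of degree d + i - 1.  Minimality is
    automatic, since all entries have positive degree as soon as d does. *)
Record linear_resolution d (I : R -> Prop) := LinearResolution {
  lrk : nat -> nat;
  ldiff : forall i, 'M[R]_(ranks lrk i.+1, ranks lrk i);
  ldiff_homog : forall i, homog_mx (lin_deg d i) (ldiff i);
  ldiff_ideal : forall f : R, I f <->
    exists v : 'rV_(ranks lrk 1), f%:M = v *m ldiff 0%N;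
  ldiff_exact : forall i (u : 'rV_(ranks lrk i.+1)),
    u *m ldiff i = 0 <-> exists v : 'rV_(ranks lrk i.+2), u = v *m ldiff i.+1
}.

Definition linear_pdim d I p := exists F : linear_resolution d I,
  ranks (lrk F) p <> 0%N /\ forall i, (p < i)%N -> ranks (lrk F) i = 0%N.

Lemma linear_pdim_iff d (I J : R -> Prop) p :
  (forall f, I f <-> J f) -> linear_pdim d I p -> linear_pdim d J p.
Proof.
move=> IJ [[b D hD idD exD] lenF].
suff idD' f : J f <-> exists v, f%:M = v *m D 0%N.
  by exists (LinearResolution hD idD' exD).
by rewrite -IJ.
Qed.

Lemma ldiff_ideal_mx d I (F : linear_resolution d I) m
    (A : 'M[R]_(m, ranks (lrk F) 0)) :
  (forall k, I (A k 0)) <-> exists X, A = X *m ldiff F 0.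
Proof.
have rowM k : row k A = (A k 0)%:M.
  by rewrite [LHS]mx11_scalar mxE.
split=> [AI | [X eA] k].
  by apply: lift_rows => k; rewrite rowM; apply/(ldiff_ideal F).
by apply/(ldiff_ideal F); exists (row k X); rewrite -rowM eA row_mul.
Qed.

Lemma ldiff1_homog J (E : linear_resolution 1 J) i : homog_mx 1 (ldiff E i).
Proof. by have := @ldiff_homog _ _ E i; case: i. Qed.

Lemma ldiffK d I (F : linear_resolution d I) i :
  ldiff F i.+1 *m ldiff F i = 0.
Proof.
apply/row_matrixP => k; rewrite row0 row_mul; apply/ldiff_exact.
by exists (delta_mx 0 k); rewrite rowE.
Qed.

Lemma ldiff_exact_mx d I (F : linear_resolution d I) i m
    (A : 'M_(m, ranks (lrk F) i.+1)) :
  A *m ldiff F i = 0 -> exists X, A = X *m ldiff F i.+1.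
Proof.
move=> A0; apply: lift_rows => k; apply/ldiff_exact.
by rewrite -row_mul A0 row0.
Qed.

Lemma linear_pdim_zero d : linear_pdim d (fun f : R => f = 0) 0.
Proof.
pose b (i : nat) := 0%N.
have hD i : homog_mx (lin_deg d i) (0 : 'M[R]_(ranks b i.+1, ranks b i)).
  by move=> j k; rewrite mxE; apply: rpred0.
have idD (f : R) : f = 0 <->
    exists v, f%:M = v *m (0 : 'M[R]_(ranks b 1, ranks b 0)).
  split=> [-> | [v]]; first by exists 0; rewrite mulmx0 raddf0.
  by rewrite mulmx0 => /matrixP/(_ 0 0); rewrite !mxE.
have exD i (u : 'rV_(ranks b i.+1)) :
    u *m (0 : 'M[R]_(ranks b i.+1, ranks b i)) = 0 <->
    exists v, u = v *m (0 : 'M[R]_(ranks b i.+2, ranks b i.+1)).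
  by split=> _; [exists 0; rewrite mulmx0 [u]thinmx0 | rewrite mulmx0].
by exists (LinearResolution hD idD exD); split=> // -[].
Qed.

(** The multiplication by g, from R / J to R / I, lifts to a homogeneous chain
    map.  The generators of E in degree i, shifted by the degree d of g, have
    degree d + i, one more than those of F; so the lift has entries of degree 1
    in positive degrees, which keeps the cone linear. *)
Lemma mapping_cone_comparison d I J (g : R) (F : linear_resolution d I)
    (E : linear_resolution 1 J) :
  g \is d.-homog -> (forall f, J f -> I (f * g)) ->
  exists phi : forall i, 'M[R]_(ranks (lrk E) i, ranks (lrk F) i),
    [/\ phi 0%N = g%:M, forall i, homog_mx (lin_deg d i) (phi i)
      & forall i, ldiff E i *m phi i = phi i.+1 *m ldiff F i].
Proof.
move=> hg JI.
pose P i (phi : 'M[R]_(ranks (lrk E) i, ranks (lrk F) i)) :=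
  homog_mx (lin_deg d i) phi /\ exists X, ldiff E i *m phi = X *m ldiff F i.
have [||phi e0 phi_chain] := @dependent_choice
  (fun i => 'M[R]_(ranks (lrk E) i, ranks (lrk F) i)) P
  (fun i phi phi' => homog_mx (lin_deg d i) phi /\
     homog_mx 1 phi' /\ ldiff E i *m phi = phi' *m ldiff F i) g%:M.
- split=> [i j|]; first by rewrite mxE !ord1.
  apply/ldiff_ideal_mx => k; rewrite mul_mx_scalar mxE mulrC; apply: JI.
  by move: k; apply/(ldiff_ideal_mx (F := E)); exists 1%:M; rewrite mul1mx.
- move=> i phi [hphi exX].
  have hE : homog_mx (1 + lin_deg d i) (ldiff E i *m phi).
    by apply: homog_mulmx => //; apply: ldiff1_homog.
  have [X hX eX] := homog_lift hE (@ldiff_homog _ _ F i) exX.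
  exists X; split=> //; split=> //; apply: ldiff_exact_mx.
  by rewrite -mulmxA -eX mulmxA ldiffK mul0mx.
by exists phi; split=> // i; have [? []] := phi_chain i.
Qed.

(** With J the colon ideal I : g, the sequence
    0 -> R / J (- d) -> R / I -> R / (I + (g)) -> 0, whose first map is the
    multiplication by g, is exact, so the cone of its lift resolves
    R / (I + (g)).  No cancellation occurs in the cone, whence the exact value
    of the length. *)
Lemma mapping_cone d (I J : R -> Prop) (g : R) p q :
  g \is d.-homog -> (forall f, I (f * g) <-> J f) ->
  linear_pdim d I p -> linear_pdim 1 J q ->
  linear_pdim d (fun f => exists a, I (f - a * g)) (maxn p q.+1).
Proof.
move=> hg IJ [F [Fp F0]] [E [Eq E0]].
have [phi [phi0 hphi phi_chain]] :=
  mapping_cone_comparison F E hg (fun f => proj2 (IJ f)).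
pose b i := (lrk F i + ranks (lrk E) i)%N.
pose D i : 'M[R]_(ranks b i.+1, ranks b i) :=
  match i with
  | 0 => col_mx (ldiff F 0) g%:M
  | j.+1 => block_mx (ldiff F j.+1) 0 (phi j.+1) (- ldiff E j)
  end.
have hD i : homog_mx (lin_deg d i) (D i).
  case: i => [|i] j k; rewrite mxE /=; case: split => l.
  - exact: (@ldiff_homog _ _ F 0).
  - by rewrite mxE !ord1.
  - rewrite mxE; case: split => m; first exact: (@ldiff_homog _ _ F i.+1).
    by rewrite mxE rpred0.
  rewrite mxE; case: split => m; first exact: (hphi i.+1).
  by rewrite mxE rpredN; apply: ldiff1_homog.
have idD f : (exists a, I (f - a * g)) <-> exists v, f%:M = v *m D 0%N.
  split=> [[a /(ldiff_ideal F) [v ev]] | [v]].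
    exists (row_mx v a%:M); rewrite mul_row_col -ev -scalar_mxM -raddfD /=.
    by rewrite subrK.
  rewrite -[v]hsubmxK mul_row_col [rsubmx v]mx11_scalar -scalar_mxM => ev.
  exists (rsubmx v 0 0); apply/(ldiff_ideal F); exists (lsubmx v).
  by rewrite raddfB /= ev addrK.
have exD i (u : 'rV_(ranks b i.+1)) :
    u *m D i = 0 <-> exists v, u = v *m D i.+1.
  (* The last component of a cycle is a cycle of E; in degree 0 this means
     that it lies in the colon ideal J. *)
  have E_part (w : 'rV_(lrk F i)) (x : 'rV_(ranks (lrk E) i)) :
      row_mx w x *m D i = 0 -> exists v, x = - v *m ldiff E i.
    case: i w x {u} => [|i] w x.
      rewrite mul_row_col => e; have : J (x 0 0).
        apply/IJ/(ldiff_ideal F); exists (- w).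
        rewrite scalar_mxM -mx11_scalar mulNmx; apply/eqP.
        by rewrite -addr_eq0 addrC e.
      case/(ldiff_ideal E) => v ev; exists (- v).
      by rewrite opprK -ev -mx11_scalar.
    rewrite mul_row_block mulmx0 add0r => /(congr1 rsubmx).
    rewrite row_mxKr linear0 mulmxN => /eqP; rewrite oppr_eq0 => /eqP.
    by case/ldiff_exact => v ->; exists (- v); rewrite opprK.
  have F_part (w : 'rV_(lrk F i)) (x : 'rV_(ranks (lrk E) i)) :
      row_mx w x *m D i = 0 -> w *m ldiff F i + x *m phi i = 0.
    case: i w x {u E_part} => [|i] w x; first by rewrite mul_row_col phi0.
    by rewrite mul_row_block => /(congr1 lsubmx); rewrite row_mxKl linear0.
  split.
    rewrite -[u]hsubmxK; move: (lsubmx u) (rsubmx u) => w x u0.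
    have [v ex] := E_part _ _ u0; move: (F_part _ _ u0).
    rewrite ex -mulmxA phi_chain mulmxA -mulmxDl => /ldiff_exact [y ey].
    (* Without the boundary of v, the cycle lies in F, where it bounds y. *)
    exists (row_mx y v); rewrite mul_row_block mulmx0 add0r -ey.
    by rewrite mulNmx mulmxN -addrA mulNmx addNr addr0.
  case=> v ->; rewrite -[v]hsubmxK; move: (lsubmx v) (rsubmx v) => w x.
  rewrite mul_row_block mulmx0 add0r.
  case: i x w {u v E_part F_part} => [|i] x w.
    rewrite mul_row_col mulmxDl -mulmxA ldiffK mulmx0 add0r -mulmxA -phi_chain.
    by rewrite phi0 mulmxN mulNmx mulmxA addrN.
  rewrite mul_row_block mulmxDl -mulmxA ldiffK mulmx0 !add0r -mulmxA -phi_chain.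
  rewrite mulmx0 add0r !mulmxN !mulNmx !mulmxA addrN.
  by rewrite -mulmxA ldiffK mulmx0 opprK row_mx0.
exists (LinearResolution hD idD exD); split=> [|[|i]] //=.
  have [pq | qp] := leqP p q.+1.
    by move/eqP; rewrite addn_eq0 => /andP[_ /eqP].
  by case: p Fp qp {F0} => //= p Fp _ /eqP; rewrite addn_eq0 => /andP[/eqP].
by rewrite gtn_max => /andP[/F0 /= Fi qi]; rewrite /b Fi E0.
Qed.

Lemma linear_pdim_is_pdim d (I : R -> Prop) p :
  (0 < d)%N -> linear_pdim d I p -> is_pdim I p.
Proof.
move=> d_gt0 [F lenF].
pose b := ranks (lrk F).
pose sh i (k : 'I_(b i)) : int := if i is j.+1 then (d + j)%N%:Z else 0.
have hD i j k : homog_deg (sh i.+1 j - sh i k) (ldiff F i j k).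
  have -> : sh i.+1 j - sh i k = (lin_deg d i)%:Z.
    case: i j k => [|i] j k /=; first by rewrite addn0 subr0.
    by rewrite addnS -addn1 PoszD addrAC subrr add0r.
  exact: ldiff_homog.
have minD i j k : (ldiff F i j k)@_0%MM = 0.
  apply: (dhomog_nemf_coeff (@ldiff_homog _ _ F i j k)).
  by rewrite mf0; case: i {j k} => [|i] //=; rewrite neq_ltn d_gt0.
have hA k : homog_deg (sh 0%N k) ((1%:M : 'cV[R]_(b 0%N)) k 0).
  by rewrite mxE !ord1; apply: dhomog1.
have I0 : I 0.
  by apply/(ldiff_ideal F); exists 0; rewrite mul0mx raddf0.
have surjA f : exists u : 'rV_(b 0%N),
    I (f - (u *m (1%:M : 'cV[R]_(b 0%N))) 0 0).
  by exists f%:M; rewrite mulmx1 mxE subrr.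
have exA (u : 'rV_(b 0%N)) : I ((u *m (1%:M : 'cV[R]_(b 0%N))) 0 0) <->
    exists v : 'rV_(b 1%N), u = v *m ldiff F 0.
  by rewrite mulmx1 (ldiff_ideal F) -mx11_scalar.
by exists (MinGradedFreeResolution hA hD surjA exA (@ldiff_exact _ _ F) minD).
Qed.

End LinearResolutions.

(** * Ideals with linear quotients *)

Section LinearQuotients.
Local Open Scope ring_scope.
Variables (K : fieldType) (n : nat).
Local Notation R := {mpoly K[n]}.

(** The ideal generated by s, by recursion on s: the conclusion of mapping_cone
    then is the ideal of a longer sequence by computation.  The last adjoined
    generator is the head of s. *)
Fixpoint seq_ideal (s : seq R) (f : R) : Prop :=
  if s is g :: s' then exists a, seq_ideal s' (f - a * g) else f = 0.

Lemma seq_ideal_is_ideal s : is_ideal (seq_ideal s).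
Proof.
elim: s => [|g s [I0 ID IM]]; split=> //=.
- by move=> f h -> ->; rewrite addr0.
- by move=> a f ->; rewrite mulr0.
- by exists 0; rewrite mul0r subr0.
- move=> f h [a fa] [b hb]; exists (a + b).
  by rewrite mulrDl opprD addrACA; apply: ID.
- by move=> c f [a fa]; exists (c * a); rewrite -mulrA -mulrBr; apply: IM.
Qed.

Lemma mem_seq_ideal (s : seq R) g : g \in s -> seq_ideal s g.
Proof.
elim: s => // h s IHs; rewrite inE => /predU1P[->|gs].
  by exists 1; rewrite mul1r subrr; case: (seq_ideal_is_ideal s).
by exists 0; rewrite mul0r subr0; apply: IHs.
Qed.

Lemma seq_idealP (s : seq R) (J : R -> Prop) c f :
  is_ideal J -> (forall g, g \in s -> J (c * g)) -> seq_ideal s f -> J (c * f).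
Proof.
case=> J0 JD JM; elim: s f => [|h s IHs] f sJ /=.
  by move->; rewrite mulr0.
case=> a fa; rewrite -[f](subrK (a * h)) mulrDr; apply: JD.
  by apply: IHs => // g gs; apply: sJ; rewrite inE gs orbT.
by rewrite mulrCA; apply/JM/sJ; rewrite inE eqxx.
Qed.

Lemma seq_ideal_sub (s : seq R) (J : R -> Prop) f :
  is_ideal J -> (forall g, g \in s -> J g) -> seq_ideal s f -> J f.
Proof.
move=> idJ sJ sf; rewrite -[f]mul1r; apply: (seq_idealP idJ) sf => g gs.
by rewrite mul1r; apply: sJ.
Qed.

Lemma linear_quotient d (s : seq R) J g p q : g \is d.-homog ->
    (forall f, seq_ideal s (f * g) <-> J f) ->
  linear_pdim d (seq_ideal s) p -> linear_pdim 1 J q ->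
  linear_pdim d (seq_ideal (g :: s)) (maxn p q.+1).
Proof. exact: mapping_cone. Qed.

Definition var_ideal (s : seq 'I_n) := seq_ideal [seq 'X_i | i <- s].

(** The retraction of R onto the polynomials in the other variables; its kernel
    is the ideal of the variables in s, which is thereby seen to be prime. *)
Definition kill_vars (s : seq 'I_n) : R -> R :=
  mmap (@mpolyC n K) (fun i => if i \in s then 0 else 'X_i).

HB.instance Definition _ s := GRing.RMorphism.on (kill_vars s).

Lemma kill_varsX s i : kill_vars s 'X_i = if i \in s then 0 else 'X_i.
Proof. by rewrite /kill_vars mmapX mmap1U. Qed.

Lemma sub_kill_vars s f : var_ideal s (f - kill_vars s f).
Proof.
have [I0 ID IM] : is_ideal (var_ideal s) := seq_ideal_is_ideal _.
have closedM f1 f2 : var_ideal s (f1 - kill_vars s f1) ->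
    var_ideal s (f2 - kill_vars s f2) ->
    var_ideal s (f1 * f2 - kill_vars s (f1 * f2)).
  move=> I1 I2; rewrite rmorphM /=; set k1 := kill_vars s f1.
  have -> : f1 * f2 - k1 * kill_vars s f2 =
      f2 * (f1 - k1) + k1 * (f2 - kill_vars s f2).
    by rewrite !mulrBr addrA -[f2 * k1]mulrC subrK mulrC.
  by apply: ID; apply: IM.
elim/mpolyind: f => [|c m f _ _ If]; first by rewrite rmorph0 subrr.
rewrite rmorphD opprD addrACA; apply: ID => //.
rewrite -mul_mpolyC; apply: (closedM).
  by rewrite /kill_vars mmapC subrr.
rewrite mpolyXE_id.
apply: (big_ind (fun f => var_ideal s (f - kill_vars s f))) => [||i _].
- by rewrite rmorph1 subrr.
- exact: closedM.
elim: (m i) => [|k IHk]; first by rewrite expr0 rmorph1 subrr.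
rewrite exprS; apply: closedM => //; rewrite kill_varsX.
case: ifP => is_; last by rewrite subrr.
by rewrite subr0; apply/mem_seq_ideal/map_f.
Qed.

Lemma var_idealE s f : var_ideal s f <-> kill_vars s f = 0.
Proof.
split=> [|kf]; last by rewrite -[f]subr0 -kf; apply: sub_kill_vars.
apply: (@seq_ideal_sub _ (fun f => kill_vars s f = 0)).
  split=> [|f1 f2|a f1]; first by rewrite rmorph0.
    by rewrite rmorphD /= => -> ->; rewrite addr0.
  by rewrite rmorphM /= => ->; rewrite mulr0.
by move=> g /mapP[i is_ ->]; rewrite kill_varsX is_.
Qed.

(** The quotient by var_ideal s embeds by kill_vars s into the domain R, and
    the variable i is fixed by kill_vars s. *)
Lemma var_ideal_colon s i f : i \notin s ->
  var_ideal s (f * 'X_i) <-> var_ideal s f.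
Proof.
move=> is_; rewrite !var_idealE rmorphM /= kill_varsX (negPf is_).
split=> [/eqP|->]; last by rewrite mul0r.
by rewrite mulf_eq0 => /orP[/eqP|/eqP/(congr1 (mcoeff U_(i)))] //;
   rewrite mcoeffX mcoeff0 eqxx => /eqP; rewrite oner_eq0.
Qed.

(** The Koszul complex, as an iterated mapping cone in which the colon ideal is
    the ideal itself. *)
Lemma linear_pdim_vars s : uniq s -> linear_pdim 1 (var_ideal s) (size s).
Proof.
elim: s => [_|i s IHs /= /andP[is_ /IHs lin_s]].
  exact: linear_pdim_zero.
have -> : (size s).+1 = maxn (size s) (size s).+1 by lia.
apply: linear_quotient (lin_s) lin_s; first by rewrite dhomogX /= mdeg1.
by move=> f; apply: var_ideal_colon.
Qed.

Definition edges_from (x : 'I_n) (zs : seq 'I_n) : seq R :=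
  [seq 'X_x * 'X_z | z <- zs].

Definition bipartite_gens (xs ys : seq 'I_n) : seq R :=
  [seq 'X_x * 'X_y | x <- xs, y <- ys].

(** Each z in zs or xs satisfies z x y = y (x z) or z x y = x (z y), a multiple
    of a generator.  Conversely all generators lie in the prime ideal
    generated by zs ++ xs, which contains neither x nor y. *)
Lemma bipartite_colon x y xs ys zs f :
    uniq (x :: xs ++ ys) -> {subset zs <= ys} -> y \in ys -> y \notin zs ->
  seq_ideal (edges_from x zs ++ bipartite_gens xs ys) (f * ('X_x * 'X_y)) <->
  var_ideal (zs ++ xs) f.
Proof.
rewrite /= mem_cat cat_uniq negb_or => /andP[/andP[x_xs x_ys] /and3P[_ dis _]].
move=> zs_ys y_ys y_zs.
have y_xs : y \notin xs by apply: contra dis => y_xs; apply/hasP; exists y.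
have x_zs : x \notin zs by apply: contra x_ys => /zs_ys.
have [V0 VD VM] : is_ideal (var_ideal (zs ++ xs)) := seq_ideal_is_ideal _.
have memV z : z \in zs ++ xs -> var_ideal (zs ++ xs) 'X_z.
  by move=> zV; apply/mem_seq_ideal/map_f.
have idV : is_ideal (var_ideal (zs ++ xs)) by [].
split=> [|fV].
  move=> /(@seq_ideal_sub _ _ _ idV) fxy.
  have x_V : x \notin zs ++ xs by rewrite mem_cat negb_or x_zs.
  have y_V : y \notin zs ++ xs by rewrite mem_cat negb_or y_zs.
  apply/(var_ideal_colon _ x_V)/(var_ideal_colon _ y_V).
  rewrite -mulrA; apply: fxy => g; rewrite mem_cat.
  case/orP=> [/mapP[z zz ->] | /allpairsP[[a b] [a_xs _ ->]]] /=.
    by apply/VM/memV; rewrite mem_cat zz.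
  by rewrite mulrC; apply/VM/memV; rewrite mem_cat a_xs orbT.
rewrite mulrC; apply: seq_idealP fV; first exact: seq_ideal_is_ideal.
move=> _ /mapP[z + ->]; rewrite mem_cat.
have [_ _ IM] := seq_ideal_is_ideal (edges_from x zs ++ bipartite_gens xs ys).
case/orP=> [z_zs | z_xs].
  rewrite mulrAC mulrC; apply/IM/mem_seq_ideal.
  by rewrite mem_cat; apply/orP; left; apply: (map_f (fun z => 'X_x * 'X_z)).
rewrite -mulrA; apply/IM/mem_seq_ideal; rewrite mem_cat mulrC.
by apply/orP; right; apply: (allpairs_f (fun a b => 'X_a * 'X_b)).
Qed.

(** Adjoining the edges from x to zs one by one, the colon ideals have
    size xs, size xs + 1, ..., size xs + size zs - 1 generators.  The bound on
    size xs makes the formula hold for empty zs as well. *)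
Lemma linear_pdim_add_vertex x xs ys zs p :
    uniq (x :: xs ++ ys) -> uniq zs -> {subset zs <= ys} -> (size xs <= p)%N ->
  linear_pdim 2 (seq_ideal (bipartite_gens xs ys)) p ->
  linear_pdim 2 (seq_ideal (edges_from x zs ++ bipartite_gens xs ys))
    (maxn p (size zs + size xs)).
Proof.
move=> U + + xs_p lin_xs; elim: zs => [_ _|y zs IHzs].
  by rewrite add0n (maxn_idPl xs_p).
rewrite cons_uniq => /andP[y_zs Uzs] zs_ys.
have y_ys : y \in ys by apply: zs_ys; rewrite inE eqxx.
have {}zs_ys : {subset zs <= ys}.
  by move=> z z_zs; apply: zs_ys; rewrite inE z_zs orbT.
have -> : maxn p (size (y :: zs) + size xs) =
    maxn (maxn p (size zs + size xs)) (size (zs ++ xs)).+1.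
  by rewrite size_cat /=; lia.
apply: linear_quotient (IHzs Uzs zs_ys) _.
- by rewrite -[2%N]/(1 + 1)%N; apply: dhomogM; rewrite dhomogX /= mdeg1.
- by move=> f; apply: bipartite_colon.
apply: linear_pdim_vars; rewrite cat_uniq Uzs /=.
move: U; rewrite cons_uniq cat_uniq => /and4P[_ -> dis _]; rewrite andbT.
apply: contra dis => /hasP[z z_xs z_zs].
by apply/hasP; exists z; first exact: zs_ys.
Qed.

Lemma linear_pdim_bipartite xs ys : uniq (xs ++ ys) -> (0 < size ys)%N ->
  linear_pdim 2 (seq_ideal (bipartite_gens xs ys))
    (if nilp xs then 0 else (size xs + size ys).-1).
Proof.
move=> + ys_gt0; elim: xs => [_|x xs IHxs U]; first exact: linear_pdim_zero.
have /andP[_ Uxs] : (x \notin xs ++ ys) && uniq (xs ++ ys) by [].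
have Uys : uniq ys by move: Uxs; rewrite cat_uniq => /and3P[].
set p := (if _ then _ else _) in IHxs.
have -> : (if nilp (x :: xs) then 0 else (size (x :: xs) + size ys).-1)%N =
    maxn p (size ys + size xs).
  by rewrite /p /=; case: ifP => _; lia.
apply: linear_pdim_add_vertex => //; last exact: IHxs.
by rewrite /p /nilp; case: eqP => [-> //|_]; lia.
Qed.

End LinearQuotients.

(** * The complement of a barbell *)

Section EdgeIdeals.
Local Open Scope ring_scope.
Variables (K : fieldType) (n : nat).
Local Notation R := {mpoly K[n]}.

Lemma ideal_gen_is_ideal (T : finType) (P : pred T) (g : T -> R) :
  is_ideal (ideal_gen P g).
Proof.
split.
- by exists (fun=> 0); rewrite big1 // => t _; rewrite mul0r.
- move=> _ _ [c ->] [c' ->]; exists (fun t => c t + c' t).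
  by rewrite -big_split; apply: eq_bigr => t _; rewrite mulrDl.
move=> a _ [c ->]; exists (fun t => a * c t).
by rewrite mulr_sumr; apply: eq_bigr => t _; rewrite mulrA.
Qed.

Lemma edge_ideal_seq (e : rel 'I_n) (s : seq R) :
    (forall i j, e i j -> ('X_i * 'X_j) \in s) ->
    (forall g, g \in s -> exists i j, e i j /\ g = 'X_i * 'X_j) ->
  forall f : R, edge_ideal e f <-> seq_ideal s f.
Proof.
move=> es se f; split=> [[c ->]|].
  have [I0 ID IM] := seq_ideal_is_ideal s.
  by elim/big_ind: _ => // -[i j] eij; apply/IM/mem_seq_ideal/es.
apply: seq_ideal_sub; first exact: ideal_gen_is_ideal.
move=> g /se[i [j [eij ->]]].
exists (fun t => if t == (i, j) then 1 else 0).
rewrite (bigD1 (i, j)) //= eqxx mul1r big1 ?addr0 // => t /andP[_ /negPf ->].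
by rewrite mul0r.
Qed.

End EdgeIdeals.

Section BarbellComplement.
Variables (r : nat) (n : nat) (B : rel 'I_n) (A : {set 'I_n}) (a b : 'I_n).
Hypotheses (hA : #|A| = r) (hA' : #|~: A| = r) (aA : a \in A) (bA : b \notin A).
Hypothesis hB : forall x y, B x y = (x != y) &&
  [|| (x \in A) == (y \in A), (x == a) && (y == b) | (x == b) && (y == a)].

Lemma graph_compl_barbellE x y : graph_compl B x y =
  ((x \in A) != (y \in A)) &&
  ~~ [|| (x == a) && (y == b) | (x == b) && (y == a)].
Proof.
rewrite /graph_compl hB negb_and negbK.
case: (x =P y) => [-> | _] /=; first by rewrite eqxx.
by rewrite negb_or.
Qed.

Lemma graph_deg_le x : graph_deg (graph_compl B) x <= r.
Proof.
case xA: (x \in A); [rewrite -hA' | rewrite -hA];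
  apply/subset_leq_card/subsetP => y;
  by rewrite !inE graph_compl_barbellE xA => /andP[]; case: (y \in A).
Qed.

Lemma graph_deg_ge : 1 < r -> exists x, graph_deg (graph_compl B) x = r.
Proof.
move=> r_gt1; have /card_gt0P[x] : 0 < #|A :\ a|.
  by move: r_gt1; rewrite -hA (cardsD1 a) aA add1n.
rewrite !inE => /andP[xa xA]; exists x.
rewrite /graph_deg -[RHS]hA'; apply: eq_card => y; rewrite !inE.
rewrite graph_compl_barbellE xA (negPf xa) /=.
have -> : (x == b) = false by apply: contraTF xA => /eqP->.
by rewrite andbT; case: (y \in A).
Qed.

Lemma max_graph_deg : 1 < r -> \max_(i < n) graph_deg (graph_compl B) i = r.
Proof.
move=> /graph_deg_ge[x degx]; apply/eqP; rewrite eqn_leq; apply/andP; split.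
  by apply/bigmax_leqP => i _; apply: graph_deg_le.
by rewrite -[X in X <= _]degx; apply: (leq_bigmax x).
Qed.

(** The vertex a is adjoined last, to the complete bipartite graph between
    A minus a and ~: A, and is joined to ~: A minus b. *)
Lemma linear_pdim_barbell_compl (K : fieldType) : 1 < r ->
  linear_pdim 2 (@edge_ideal K n (graph_compl B)) (2 * r - 2).
Proof.
move=> r_gt1.
pose xs := enum (A :\ a); pose zs := enum (~: A :\ b); pose ys := b :: zs.
have size_xs : size xs = r.-1.
  by rewrite -cardE; have := cardsD1 a A; rewrite hA aA => ->.
have size_zs : size zs = r.-1.
  by rewrite -cardE; have := cardsD1 b (~: A); rewrite hA' inE bA => ->.
have in_xs x : (x \in xs) = (x != a) && (x \in A) by rewrite mem_enum !inE.
have in_zs y : (y \in zs) = (y != b) && (y \notin A) by rewrite mem_enum !inE.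
have in_ys y : (y \in ys) = (y \notin A).
  by rewrite inE in_zs; case: eqP => [->|]; rewrite ?bA.
have U : uniq (a :: xs ++ ys).
  have Uys : uniq ys by rewrite cons_uniq in_zs eqxx enum_uniq.
  have dis : ~~ has (mem xs) ys.
    by apply/hasPn => y; rewrite in_ys /= in_xs => /negPf->; rewrite andbF.
  by rewrite cons_uniq mem_cat in_xs eqxx in_ys aA cat_uniq enum_uniq Uys dis.
have -> : 2 * r - 2 = maxn (2 * r - 2) (size zs + size xs) by lia.
apply: (@linear_pdim_iff _ _ _
  (seq_ideal (edges_from K a zs ++ bipartite_gens K xs ys))).
  move=> f; symmetry; apply: edge_ideal_seq => [i j|g].
    rewrite graph_compl_barbellE.
    (* Every edge has one end in A; swap the ends if it is the second one. *)
    wlog iA : i j / i \in A => [Hw|].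
      move=> eij; case/boolP: (i \in A) => [/Hw|iA]; first exact.
      rewrite mulrC; apply: Hw.
        by move: eij; rewrite (negPf iA); case: (j \in A).
      by rewrite eq_sym orbC [(j == a) && _]andbC [(j == b) && _]andbC.
    rewrite iA; case jA: (j \in A) => //=.
    rewrite negb_or => /andP[nab _]; rewrite mem_cat.
    case: (eqVneq i a) nab => [-> | ia] /= nab.
      by apply/orP; left; apply: map_f; rewrite in_zs jA nab.
    apply/orP; right; apply: (allpairs_f (fun x y => 'X_x * 'X_y)%R).
      by rewrite in_xs ia.
    by rewrite in_ys jA.
  rewrite mem_cat => /orP[/mapP[z + ->] | /allpairsP[[x y] /= [+ + ->]]].
    rewrite in_zs => /andP[zb zA]; exists a, z; split=> //.
    rewrite graph_compl_barbellE aA (negPf zA) (negPf zb) andbF /=.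
    by apply/negP => /andP[/eqP ab]; move: bA; rewrite -ab aA.
  rewrite in_xs in_ys => /andP[xa xA] yA; exists x, y; split=> //.
  rewrite graph_compl_barbellE xA (negPf yA) (negPf xa) /=.
  by apply/negP => /andP[/eqP xb]; move: bA; rewrite -xb xA.
apply: linear_pdim_add_vertex => //.
- exact: enum_uniq.
- by move=> z; rewrite in_zs in_ys => /andP[].
- by rewrite size_xs; lia.
have /andP[_ Uxs] : (a \notin xs ++ ys) && uniq (xs ++ ys) by [].
have := linear_pdim_bipartite K Uxs isT.
rewrite /nilp /= size_xs size_zs.
have -> : (r.-1 == 0) = false by lia.
by have -> : (r.-1 + r.-1.+1).-1 = 2 * r - 2 by lia.
Qed.

End BarbellComplement.

Theorem mainTheorem5 (r : nat) (hr : (3 <= r)%N) (K : fieldType)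
    (B G : rel 'I_(2 * r)) (hB : is_barbell r B) (hG : G = graph_compl B) :
  let pdim := pdim_stanley_reisner K (independence_complex G) in
  let maxdeg := (\max_(i < 2 * r) graph_deg G i)%N in
  [/\ pdim = (2 * r - 2)%N,
      maxdeg = r
    & (pdim%:Z - maxdeg%:Z = r%:Z - 2%:Z)%R].
Proof.
case: hB => A [a [b [hA hA' aA bA eB]]] pdim maxdeg.
have r_gt1 : 1 < r by apply: leq_trans hr.
have pdimE : pdim = 2 * r - 2.
  apply: pdim_quotientE; first exact: ideal_gen_is_ideal.
  apply: (@linear_pdim_is_pdim _ _ 2) => //.
  apply: linear_pdim_iff (linear_pdim_barbell_compl hA hA' aA bA eB K r_gt1).
  move=> f; rewrite -hG; symmetry; apply: stanley_reisner_independence.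
  by move=> x; rewrite hG /graph_compl eqxx.
have maxdegE : maxdeg = r.
  by rewrite /maxdeg hG; apply: max_graph_deg hA hA' aA bA eB r_gt1.
by split=> //; rewrite pdimE maxdegE; lia.
Qed.
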